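(* Let $k\ge1$. The probability mass function $g_n^{(I)}(x)=P(N_n^{(I)}=x)$ satisfies, for $n>k$, the recursive scheme $$g_{n}^{(I)}(x)=g_{n-1}^{(I)}(x)+p^{k}g_{n-k}^{(I)}(x-1)-p^{k}q\,g_{n-k-1}^{(I)}(x)-p^{k+1}g_{n-k-1}^{(I)}(x-1),$$ with initial conditions $g_{n}^{(I)}(x)=\delta_{x,0}$ for $0\le n<k$, and $g_{k}^{(I)}(0)=1-p^{k}$, $g_{k}^{(I)}(1)=p^{k}$, $g_{k}^{(I)}(x)=0$ for $x\ge2$.
   Context: $(X_i)_{i\ge1}$ is an infinite sequence of independent Bernoulli trials with $P(X_i=1)=p$, $0<p<1$, and $P(X_i=0)=q=1-p$. $N_n^{(I)}$ is the number of success runs of length $k$ in the first $n$ trials under non-overlapping counting (scanning left to right, each time $k$ consecutive ones are completed a run is counted and counting starts anew from scratch). Conventions: $x$ is a nonnegative integer and $g_n^{(I)}(x)=0$ for $x<0$; $\delta_{x,0}$ is the Kronecker delta. *)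

(* Defs.v *)
From HB Require Import structures.
From mathcomp Require Import all_boot all_order all_algebra finmap.
From mathcomp Require Import all_classical all_reals all_analysis.

Set Implicit Arguments.
Unset Strict Implicit.
Unset Printing Implicit Defensive.

Import Order.TTheory GRing.Theory Num.Theory.

Local Open Scope classical_set_scope.
Local Open Scope ring_scope.

Definition mutually_independent d d' (T : measurableType d)
    (T' : measurableType d') (R : realType) (P : probability T R)
    (I : choiceType) (X : I -> {RV P >-> T'}) : Prop :=
  forall (J : {fset I}) (A : I -> set T'),
    (forall i, i \in J -> measurable (A i)) ->
    P (\bigcap_(i in [set` J]) (X i @^-1` A i)) =
    (\prod_(i <- J) P (X i @^-1` A i))%E.

(* [true] is a success (1), [false] a failure (0). *)
Definition bernoulli_trials d (T : measurableType d) (R : realType)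
    (P : probability T R) (p q : R) (X : nat -> {RV P >-> bool}) : Prop :=
  [/\ mutually_independent X,
      forall i, P (X i @^-1` [set true]) = p%:E
    & forall i, P (X i @^-1` [set false]) = q%:E].

(* [c] is the number of consecutive successes read since the last failure or
   the last counted run. *)
Fixpoint scan_runs (k c : nat) (s : seq bool) : nat :=
  if s is b :: s' then
    if b then
      if c.+1 == k then (scan_runs k 0 s').+1 else scan_runs k c.+1 s'
    else scan_runs k 0 s'
  else 0.

Section number_of_runs.
Context d (T : measurableType d) (R : realType) (P : probability T R).
Variable (X : nat -> {RV P >-> bool}).

(* The trials are indexed from 0: [X i] is the (i+1)-st one, so the first n
   trials are X 0, ..., X (n - 1). *)
Definition num_runs (k n : nat) (t : T) : nat :=
  scan_runs k 0 [seq X i t | i <- iota 0 n].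

Lemma measurable_scan_runs k c (s : seq nat) :
  measurable_fun setT (fun t => scan_runs k c [seq X i t | i <- s]).
Proof.
elim: s c => [|i s IHs] c /=; first exact: measurable_cst.
apply: measurable_fun_ifT; [exact: measurable_funPT | | exact: IHs].
case: (c.+1 == k); last exact: IHs.
by apply: (measurableT_comp (f := succn)); [|exact: IHs].
Qed.

Lemma measurable_num_runs k n : measurable_fun setT (num_runs k n).
Proof. exact: measurable_scan_runs. Qed.

HB.instance Definition _ k n :=
  isMeasurableFun.Build _ _ _ _ (num_runs k n) (measurable_num_runs k n).

(* The argument is an integer so that the value at x - 1 makes sense when
   x = 0; the value at a negative integer is the probability of the empty
   event, that is 0. *)
Definition runs_pmf (k n : nat) (x : int) : R :=
  fine (P [set t | (num_runs k n t)%:Z = x]).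

Lemma runs_pmf_lt0 k n (x : int) : x < 0 -> runs_pmf k n x = 0.
Proof.
move=> x0; rewrite /runs_pmf (_ : [set t | _] = set0) ?measure0//.
by rewrite -subset0 => t /= tx; move: x0; rewrite -tx.
Qed.

End number_of_runs.

(* Main.v *)
(* Reading the first trial gives a one-step recursion for the law of the number
   of runs completed from a partial run of length c.  From c = k - j the
   combination f n - p f (n - 1) telescopes along the partial run, and for
   j = k (no partial run) this is the claimed four-term recursion. *)
Require Import Defs.
From mathcomp Require Import all_boot all_order all_algebra finmap.
From mathcomp Require Import all_classical all_reals all_analysis.
From mathcomp Require Import ring zify.
Import Order.TTheory GRing.Theory Num.Theory.
Local Open Scope ring_scope.

Section run_law.
Context {R : comPzRingType}.
Implicit Types (p q : R) (k c n j : nat) (x : int).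

(* The probability that n further trials complete x runs when the scan has
   already read c consecutive successes. *)
Fixpoint run_law p q k c n x : R :=
  if n is n'.+1 then
    p * (if c.+1 == k then run_law p q k 0 n' (x - 1)
         else run_law p q k c.+1 n' x) + q * run_law p q k 0 n' x
  else (x == 0)%:R.

Lemma run_law_short p q k c n x : p + q = 1 -> (c + n < k)%N ->
  run_law p q k c n x = (x == 0)%:R.
Proof.
move=> pq; elim: n c => [//|n IHn] c cnk /=.
rewrite ifF; last by apply/eqP; lia.
by rewrite !IHn; [rewrite -mulrDl pq mul1r | lia | lia].
Qed.

(** Only an unbroken string of [n] successes completes the run: after a failure fewer than [k]
    trials remain, so [run_law_short] applies. Allowing a partial run [c] lets the induction go
    through; [c = 0] gives the initial values at [n = k]. *)
Lemma run_law_full p q k c n x : p + q = 1 -> (0 < n)%N -> (c + n = k)%N ->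
  run_law p q k c n x = p ^+ n * (x == 1)%:R + (1 - p ^+ n) * (x == 0)%:R.
Proof.
move=> pq; have qE : q = 1 - p by rewrite -pq addrC addKr.
elim: n c => [//|[|n] IHn] c _ cnk.
  by rewrite /= ifT ?subr_eq0 ?qE ?expr1//; apply/eqP; lia.
have -> : run_law p q k c n.+2 x =
    p * run_law p q k c.+1 n.+1 x + q * run_law p q k 0 n.+1 x.
  by rewrite [LHS]/= ifF//; apply/eqP; lia.
rewrite IHn//; last lia.
rewrite (run_law_short _ _ _ 0)//; last lia.
by rewrite qE (exprS p n.+1); ring.
Qed.

(** [j] counts the successes missing from the current run. The induction on it starts at [j = 1],
    where a success completes the run and unfolding one trial suffices. *)
Lemma run_law_rec p q k c j n x : (0 < j)%N -> (c + j = k)%N -> (j < n.+1)%N ->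
  run_law p q k c n.+1 x = p * run_law p q k c n x + q * run_law p q k 0 n x
    + p ^+ j * run_law p q k 0 (n.+1 - j) (x - 1)
    - p ^+ j * q * run_law p q k 0 (n - j) x
    - p ^+ j.+1 * run_law p q k 0 (n - j) (x - 1).
Proof.
have lawS c' n' : run_law p q k c' n'.+1 x =
    p * (if c'.+1 == k then run_law p q k 0 n' (x - 1)
         else run_law p q k c'.+1 n' x) + q * run_law p q k 0 n' x by [].
elim: j c n => [//|[|j] IHj] c [|n]// _ cjk jn.
  have ck : c.+1 == k by apply/eqP; lia.
  by rewrite !lawS ck !subSS !subn0; ring.
have ck : c.+1 == k = false by apply/eqP; lia.
(* Multiplied by [p], the first two terms of the induction hypothesis reassemble into
   [p * run_law p q k c n.+1 x]; the others only gain a factor [p]. *)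
rewrite (lawS c n.+1) (lawS c n) ck (IHj c.+1 n)//; last lia.
by rewrite !subSS !(exprS p); ring.
Qed.

End run_law.

Section bernoulli_trials_theory.
Local Open Scope classical_set_scope.
Context {d : measure_display} {T : measurableType d} {R : realType}.
Context {P : probability T R} {p q : R} {X : nat -> {RV P >-> bool}}.
Context (trialsX : bernoulli_trials p q X).

(** Puts the event of reading a given word into the shape to which mutual independence applies. *)
Lemma word_bigcap (w : seq bool) :
  [set t | [seq X i t | i <- iota 0 (size w)] = w] =
  \bigcap_(i in `I_(size w)) (X i @^-1` [set nth false w i]).
Proof.
apply/seteqP; split => t /=.
  move=> wt i /= iw.
  by rewrite -[in RHS]wt (nth_map 0%N) ?size_iota// nth_iota.
move=> wt; apply: (@eq_from_nth _ false); first by rewrite size_map size_iota.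
move=> i; rewrite size_map size_iota => iw.
by rewrite (nth_map 0%N) ?size_iota// nth_iota// add0n; exact: wt.
Qed.

Lemma prob_word (w : seq bool) :
  P [set t | [seq X i t | i <- iota 0 (size w)] = w] =
  (\prod_(b <- w) (if b then p else q))%:E.
Proof.
case: trialsX => indep Ptrue Pfalse.
have PX i b : P (X i @^-1` [set b]) = (if b then p else q)%:E by case: b.
pose J := [fset i in iota 0 (size w)]%fset.
have := indep J (fun i => [set nth false w i]) (fun i _ => I).
rewrite (_ : [set` J] = `I_(size w)); last first.
  by apply/seteqP; split=> i /=; rewrite !inE mem_iota.
rewrite -word_bigcap => ->; have JE : perm_eq J (iota 0 (size w)).
  apply: uniq_perm; [exact: fset_uniq | exact: iota_uniq |].
  by move=> i; rewrite inE.
rewrite (perm_big _ JE) /=.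
under eq_bigr do rewrite PX.
rewrite prodEFin; congr EFin.
by rewrite [RHS](big_nth false) /index_iota subn0.
Qed.

Lemma measurable_word (w : seq bool) :
  measurable [set t | [seq X i t | i <- iota 0 (size w)] = w].
Proof.
by rewrite word_bigcap; apply: bigcap_measurableType => i _; exact: measurable_funPTI.
Qed.

(** Carrying the word [w] already read replaces conditioning: the induction on [n] moves the next
    trial from the scan to the end of [w]. The state [c] is arbitrary, not computed from [w]. *)
Lemma prob_scan_after_word (k c n : nat) (x : int) (w : seq bool) :
  P ([set t | [seq X i t | i <- iota 0 (size w)] = w] `&`
     [set t | (scan_runs k c [seq X i t | i <- iota (size w) n])%:Z = x]) =
  ((\prod_(b <- w) (if b then p else q)) * run_law p q k c n x)%:E.
Proof.
elim: n c x w => [|n IHn] c x w.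
  (* With no trial left the scan counts nothing: the event is the word event if [x = 0] and empty
     otherwise. *)
  rewrite [run_law _ _ _ _ _ _]/= eq_sym; case: eqP => [<-|x0].
    by rewrite mulr1 -prob_word; congr (P _); apply/seteqP; split=> t //= [].
  by rewrite mulr0 -[RHS](measure0 P); congr (P _); apply/seteqP; split=> t [].
pose W (v : seq bool) := [set t | [seq X i t | i <- iota 0 (size v)] = v].
pose S c' y := [set t |
  (scan_runs k c' [seq X i t | i <- iota (size w).+1 n])%:Z = y].
have WE b t : W (rcons w b) t <-> W w t /\ X (size w) t = b.
  rewrite /W /= size_rcons -[in iota _ _]addn1 iotaD /= add0n map_cat cats1.
  split=> [|[-> ->]//] /eqP; rewrite eqseq_rcons => /andP[/eqP-> /eqP->].
  by [].
have mS c' y : measurable (S c' y).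
  rewrite -[S c' y]setTI.
  exact: (measurable_scan_runs X k c' (iota (size w).+1 n) measurableT
           (Y := [set m | m%:Z = y])).
have PS b c' y : P (W (rcons w b) `&` S c' y) =
    ((\prod_(b <- w) (if b then p else q)) *
     ((if b then p else q) * run_law p q k c' n y))%:E.
  by rewrite mulrA -big_rcons -IHn /W /S size_rcons.
(* State and remaining count after a success: completing a run resets the state and uses up one of
   the [x] runs. *)
pose c1 := if c.+1 == k then 0%N else c.+1.
pose x1 : int := if c.+1 == k then x - 1 else x.
have -> : W w `&` [set t |
      (scan_runs k c [seq X i t | i <- iota (size w) n.+1])%:Z = x] =
    (W (rcons w true) `&` S c1 x1) `|` (W (rcons w false) `&` S 0%N x).
  apply/seteqP; split => t /=; rewrite !WE /S /c1 /x1 /=.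
    by case: (X (size w) t) => -[Ww]; last (by right);
       case: eqP => _ st; left; do !split=> //; lia.
  by case=> -[[Ww ->]] //; case: (c.+1 == k) => st; split=> //; lia.
rewrite measureU; last 3 first.
- by apply: measurableI => //; exact: measurable_word.
- by apply: measurableI => //; exact: measurable_word.
- by rewrite -subset0 => t /= [[/WE[_ Xt] _] [/WE[_]]]; rewrite Xt.
rewrite [X in (X + _)%E]PS [X in (_ + X)%E]PS -EFinD -mulrDr /c1 /x1 /=.
by case: eqP.
Qed.

Lemma runs_pmfE (k n : nat) (x : int) :
  runs_pmf X k n x = run_law p q k 0 n x.
Proof.
(* The empty word is read surely, so only the scan event remains. *)
have := prob_scan_after_word k 0 n x [::].
rewrite big_nil mul1r => /(congr1 fine) /= <-.
by congr (fine (P _)); apply/seteqP; split=> t //= [].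
Qed.

End bernoulli_trials_theory.

Theorem theorem4p1 (d : measure_display) (T : measurableType d) (R : realType)
    (P : probability T R) (p q : R) (X : nat -> {RV P >-> bool}) (k : nat)
    (hp : 0 < p < 1) (hq : q = 1 - p)
    (hX : bernoulli_trials p q X) (hk : (1 <= k)%N) :
  let g := runs_pmf X k in
  [/\ forall (n x : nat), (k < n)%N ->
        g n x%:Z = g (n - 1)%N x%:Z + p ^+ k * g (n - k)%N (x%:Z - 1)
          - p ^+ k * q * g (n - k - 1)%N x%:Z
          - p ^+ (k + 1) * g (n - k - 1)%N (x%:Z - 1),
      forall (n x : nat), (n < k)%N -> g n x%:Z = (x == 0%N)%:R,
      g k 0 = 1 - p ^+ k,
      g k 1 = p ^+ k
    & forall x : nat, (2 <= x)%N -> g k x%:Z = 0].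
Proof.
have pq : p + q = 1 by rewrite hq addrC subrK.
have gE n x : runs_pmf X k n x = run_law p q k 0 n x := runs_pmfE hX k n x.
split=> [[//|n] x kn|n x nk||| x x2]; rewrite /= !gE.
(* For [c = 0] and [j = k] the first two terms are [p] and [q] times the same value and merge, since
   [p + q = 1]. *)
- rewrite (run_law_rec _ _ _ _ k)// !subSS subn0 subnAC subn1 addn1.
  by rewrite -mulrDl pq mul1r.
- by rewrite run_law_short.
- by rewrite run_law_full//= mulr0 add0r mulr1.
- by rewrite run_law_full//= mulr0 addr0 mulr1.
- rewrite run_law_full//; have [-> ->] : (x%:Z == 1) = false /\ (x%:Z == 0) = false.
    by split; apply/eqP; lia.
  by rewrite !mulr0 addr0.
Qed.
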